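(* Let $\alpha \in \mathbb{R} \setminus \mathbb{Q}$ have continued fraction expansion $[a_0;a_1;a_2;\ldots]$, let $s \in \mathbb{N}$ and assume that $a_i \leq s$ for all $i \in \mathbb{N}$. Let $f_\alpha$ be the rotation $x \mapsto x+\alpha \bmod 1$ of the unit torus. Then $$F_n(f_\alpha) \to 1 \quad \text{for } n \to \infty.$$ Moreover, if $a_i = s$ for all $i \geq 0$ (that is, $\alpha = [s;s;s;\ldots]$), then for all integers $j \geq 0$ and all $n \in \mathbb{N}$ with $n \geq \alpha^{j-1}(\alpha+1)$, $$F_n(f_\alpha) \geq F_1(f_\alpha)\, \frac{1}{\alpha^{j+2}}\left(\lfloor \alpha^{j+1} \rfloor \lfloor \alpha \rfloor + \lfloor \alpha^j \rfloor\right).$$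
   Context: Let $\mathbb{T}_1 = [0,1)$ be the unit torus (endpoints glued), equipped with the Lebesgue probability measure $\mu$. For irrational $\alpha$, $f_\alpha:\mathbb{T}_1\to\mathbb{T}_1$ is $f_\alpha(x) = x+\alpha \bmod 1$. An interval is an arc of the torus that is closed on the left and open on the right, of positive length. For $n \in \mathbb{N}$ (positive integers) and a transformation $T$ of $\mathbb{T}_1$ preserving $\mu$, the covering number by $n$ intervals $F_n(T)$ is the supremum of all $z \in \mathbb{R}$ such that for every $h_0 \in \mathbb{N}$ there exist an integer $h \geq h_0$ and a set $B$ that is a union of $n$ pairwise disjoint intervals such that (1) $B, TB, \ldots, T^{h-1}B$ are pairwise disjoint, and (2) $\mu\left(\bigcup_{k=0}^{h-1} T^k B\right) \geq z$. The $n$ disjoint intervals making up $B$ are allowed to be adjacent (the right endpoint of one may equal the left endpoint of the next): up to rotation, $B = \bigcup_{i=1}^{n} [c_i, c_i+\beta_i)$ with $c_1 = 0$, $\beta_i>0$ and $c_i \geq c_{i-1}+\beta_{i-1}$ for $2 \le i \le n$. *)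

(* Defs.v *)
From mathcomp Require Export all_boot all_order all_algebra.
From mathcomp Require Export all_classical all_reals all_analysis.
Import Order.TTheory GRing.Theory Num.Theory.
Import numFieldNormedType.Exports.

Set Implicit Arguments.
Unset Strict Implicit.
Unset Printing Implicit Defensive.

Local Open Scope classical_set_scope.
Local Open Scope ring_scope.

(* [a 0; a 1; ...; a n] *)
Fixpoint cf_convergent (R : realType) (a : nat -> int) (n : nat) : R :=
  match n with
  | 0 => (a 0%N)%:~R
  | m.+1 => (a 0%N)%:~R + (cf_convergent R (fun i => a i.+1) m)^-1
  end.

(* x = [a 0; a 1; a 2; ...]; only a 0 may be nonpositive *)
Definition is_cf_expansion (R : realType) (x : R) (a : nat -> int) : Prop :=
  (forall i : nat, (0 < i)%N -> 0 < a i) /\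
  cf_convergent R a n @[n --> \oo] --> x.

(* The unit torus is the subset `[0, 1[ of R, its probability measure being the
   restriction of the Lebesgue measure; mod1 is the projection R -> R / Z. *)
Definition mod1 (R : realType) (x : R) : R := x - (Num.floor x)%:~R.

Definition rotation (R : realType) (alpha x : R) : R := mod1 (x + alpha).

(* Arcs may wrap around the point 0. *)
Definition is_arc (R : realType) (I : set R) : Prop :=
  exists c b : R, [/\ 0 <= c < 1, 0 < b <= 1 & I = @mod1 R @` `[c, c + b[].

(* The arcs are disjoint but may be adjacent. *)
Definition union_of_arcs (R : realType) (n : nat) (B : set R) : Prop :=
  exists I : 'I_n -> set R,
    [/\ forall i, is_arc (I i), trivIset setT I & B = \bigcup_i I i].

Definition tower_level (R : realType) (T : R -> R) (B : set R) (k : nat) :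
  set R := iter k T @` B.

(* B, T B, ..., T^(h-1) B are disjoint and cover measure at least z. *)
Definition tower_covers (R : realType) (T : R -> R) (B : set R) (h : nat)
    (z : R) : Prop :=
  trivIset `I_h (tower_level T B) /\
  (z%:E <= (@lebesgue_measure R) (\bigcup_(k in `I_h) tower_level T B k))%E.

(* Meant for n > 0 and T a measure-preserving self-map of `[0, 1[. The set is
   bounded above by 1; should it be empty, sup returns 0. It is not empty when
   T is an irrational rotation. *)
Definition covering_number (R : realType) (n : nat) (T : R -> R) : R :=
  sup [set z : R | forall h0 : nat, (0 < h0)%N ->
    exists h B, [/\ (h0 <= h)%N, union_of_arcs n B & tower_covers T B h z]].

(* Main.v *)
Require Import Defs.
From mathcomp Require Import ring lra zify.
Import Order.TTheory GRing.Theory Num.Theory.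
Import numFieldNormedType.Exports.

(* Let q' < q be consecutive convergent denominators of alpha, with errors
   d' = |q' alpha - p'| and d = |q alpha - p|.  The circle is tiled by a tower
   of q arcs of width d' and a tower of q' arcs of width d.  Cutting both towers
   into slices of a common height h leaves one tower of height h whose base
   consists of q/h + q'/h arcs, and loses at most a measure h (d + d').  With
   bounded partial quotients, h ~ q'/N keeps the number of arcs bounded and the
   loss below 1/N, whence the limit.  When all partial quotients equal s, one has
   d = d'/alpha and q ~ alpha q', and h ~ q / alpha^j gives
   N1 = floor(alpha^j) and N2 = floor(alpha^(j-1)) slices, that is a measure
   close to q d' (N1 + N2 / alpha) / alpha^j.  On the other hand, a single arc
   that is the base of a tower of height in (q', q] has width at most d', so
   such towers cover at most q d'. *)

Local Open Scope classical_set_scope.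
Local Open Scope ring_scope.

(** * Arcs of the circle: membership, rotation and measure *)

Section Arcs.
Set Implicit Arguments.
Unset Strict Implicit.
Unset Printing Implicit Defensive.
Context {R : realType}.
Implicit Types (c b x y alpha : R).

Lemma mod1_itv x : 0 <= mod1 x < 1.
Proof. by have := floor_itv x; rewrite /mod1 intrD; lra. Qed.

Lemma mod1Dz x (m : int) : mod1 (x + m%:~R) = mod1 x.
Proof. by rewrite /mod1 floorDrz ?intr_int// intrKfloor intrD; ring. Qed.

Lemma mod1_eqP x y : mod1 x = mod1 y <-> exists m : int, x = y + m%:~R.
Proof.
split=> [|[m ->]]; last exact: mod1Dz.
rewrite /mod1 => xy; exists (Num.floor x - Num.floor y).
by rewrite intrB; lra.
Qed.

Lemma mod1_id x : 0 <= x < 1 -> mod1 x = x.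
Proof. by move=> x01; rewrite /mod1 (@floor_def _ x 0) ?subr0. Qed.

(** The start [c] may be any real, so that rotated arcs need no reduction modulo 1. *)
Definition arc c b : set R := @mod1 R @` `[c, c + b[.

Lemma arcP c b x : arc c b (mod1 x) <-> exists m : int, c <= x + m%:~R < c + b.
Proof.
split=> [[y /= yI /mod1_eqP[m ym]]|[m xI]].
  by exists m; rewrite -ym; move: yI; rewrite /= in_itv.
by exists (x + m%:~R); rewrite ?mod1Dz//= in_itv.
Qed.

Lemma arc_sub c b : arc c b `<=` `[0, 1[.
Proof. by move=> _ [x _ <-] /=; rewrite in_itv /= mod1_itv. Qed.

Lemma eq_arc c c' b : mod1 c = mod1 c' -> arc c b = arc c' b.
Proof.
move=> /mod1_eqP[m ->]; apply/seteqP; split=> _ [x + <-] /=; rewrite /= in_itv /= => xI.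
  by apply/arcP; exists (- m); rewrite intrN; lra.
by apply/arcP; exists m; lra.
Qed.

Lemma arc_mod1 c b : arc c b = arc (mod1 c) b.
Proof. by apply: eq_arc; rewrite (mod1_id (mod1_itv c)). Qed.

Lemma arc_is_arc c b : 0 < b <= 1 -> is_arc (arc c b).
Proof.
move=> b01; exists (mod1 c), b.
by split; rewrite ?mod1_itv// arc_mod1.
Qed.

Lemma iter_rotation alpha k x :
  iter k (rotation alpha) (mod1 x) = mod1 (x + k%:R * alpha).
Proof.
elim: k => [|k IH]; first by rewrite mul0r addr0.
rewrite iterS IH /rotation; apply/mod1_eqP.
exists (- Num.floor (x + k%:R * alpha)).
by rewrite /mod1 -natr1 intrN; ring.
Qed.

Lemma iter_rotation_arc alpha k c b :
  iter k (rotation alpha) @` arc c b = arc (c + k%:R * alpha) b.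
Proof.
apply/seteqP; split=> [_ [_ [x + <-] <-]|_ [x + <-]]; rewrite /= in_itv /= => xI.
  by rewrite iter_rotation; apply/arcP; exists 0; lra.
exists (mod1 (x - k%:R * alpha)); last by rewrite iter_rotation subrK.
by apply/arcP; exists 0; lra.
Qed.

(** Cutting a wrapping arc at 0 reduces measurability and measure to ordinary intervals. *)
Lemma arcE c b : 0 <= c < 1 -> 0 <= b <= 1 ->
  arc c b = if c + b <= 1 then `[c, c + b[%classic
            else `[c, 1[%classic `|` `[0, c + b - 1[%classic.
Proof.
move=> c01 b01; case: ifPn => cb1; apply/seteqP; split.
- by move=> _ [x + <-] /=; rewrite /= !in_itv /= => xI; rewrite mod1_id//; lra.
- move=> x /=; rewrite /= in_itv/= => xI; rewrite -(@mod1_id x); last by lra.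
  by apply/arcP; exists 0; lra.
- move=> _ [x + <-] /=; rewrite /= !in_itv /= => xI; have [x1|x1] := ltP x 1.
    by left; rewrite mod1_id; lra.
  by right; rewrite -(mod1Dz x (-1)) mod1_id; lra.
- move=> x /= [] /[!in_itv]/= xI; rewrite -(@mod1_id x); try lra.
    by apply/arcP; exists 0; lra.
  by apply/arcP; exists 1; lra.
Qed.

Lemma measurable_arc c b : 0 <= b <= 1 -> measurable (arc c b).
Proof.
move=> b01; rewrite arc_mod1 arcE ?mod1_itv//.
by case: ifP => _; [|apply: measurableU].
Qed.

Lemma lebesgue_measure_arc c b :
  0 <= b <= 1 -> lebesgue_measure (arc c b) = b%:E.
Proof.
move=> b01; have c01 := mod1_itv c.
rewrite arc_mod1 arcE//; set c' := mod1 c in c01 *.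
have itvE (x y : R) : x <= y -> lebesgue_measure `[x, y[%classic = (y - x)%:E.
  move=> xy; rewrite lebesgue_measure_itv/= lte_fin -EFinD.
  by case: ltgtP xy => // -> _; rewrite subrr.
case: ifPn => cb1; first by rewrite itvE; [congr (_%:E); lra|lra].
rewrite measureU//=.
  by rewrite !itvE; [rewrite -EFinD; congr (_%:E); lra|lra|lra].
by apply/seteqP; split=> x //= [] /[!in_itv]/=; lra.
Qed.

End Arcs.

(** * Towers over unions of arcs *)

Section Towers.
Set Implicit Arguments.
Unset Strict Implicit.
Unset Printing Implicit Defensive.
Context {R : realType}.
Implicit Types (c x y alpha : R).

Lemma tower_level_arcs alpha n (x b : 'I_n -> R) k :
  tower_level (rotation alpha) (\bigcup_i arc (x i) (b i)) k =
  \bigcup_i arc (x i + k%:R * alpha) (b i).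
Proof.
rewrite /tower_level image_bigcup.
by apply: eq_bigcupr => i _; rewrite iter_rotation_arc.
Qed.

Lemma lebesgue_measure_tower alpha n (x b : 'I_n -> R) h :
  (forall i, 0 <= b i <= 1) -> trivIset setT (fun i => arc (x i) (b i)) ->
  trivIset `I_h (tower_level (rotation alpha) (\bigcup_i arc (x i) (b i))) ->
  lebesgue_measure (\bigcup_(k in `I_h)
    tower_level (rotation alpha) (\bigcup_i arc (x i) (b i)) k) =
  (h%:R * \sum_i b i)%:E.
Proof.
move=> b01 arcs_disj levels_disj; set T := tower_level _ _ in levels_disj *.
have T_measurable k : measurable (T k).
  rewrite /T tower_level_arcs; apply: fin_bigcup_measurable => // i _.
  exact: measurable_arc.
have T_measure k : lebesgue_measure (T k) = (\sum_i b i)%:E.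
  rewrite /T tower_level_arcs measure_fin_bigcup//=.
  - rewrite (fsbig_fwiden (index_enum 'I_n)) ?index_enum_uniq//.
    + by rewrite -sumEFin; apply: eq_bigr => i _; exact: lebesgue_measure_arc.
    + by move=> i _; exact: mem_index_enum.
    + by rewrite setDT; exact: sub0set.
  (* A point common to two arcs of level [k], rotated back by [k%:R * alpha], would be common to two
     arcs of the base. *)
  - apply/trivIsetP => i j _ _ ij; apply/seteqP; split=> // _ [[y + <-]].
    rewrite /= in_itv /= => yi /arcP[m yj].
    move/trivIsetP: arcs_disj => /(_ i j I I ij)/seteqP[+ _].
    move=> /(_ (mod1 (y - k%:R * alpha))); apply; split; apply/arcP.
      by exists 0; lra.
    by exists m; lra.
  - by move=> i _; exact: measurable_arc.
rewrite measure_fin_bigcup//=; last by move=> k _; exact: T_measurable.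
transitivity (\sum_(k < h) (lebesgue_measure (T k)))%E.
  by rewrite (fsbig_ord _ _ (fun k => lebesgue_measure (T k))).
rewrite (eq_bigr (fun=> (\sum_i b i)%:E)) => [|k _]; last exact: T_measure.
by rewrite sumEFin sumr_const card_ord mulr_natl.
Qed.

(** Disjointness becomes a condition on coincidences modulo integers: [k = l = 0] separates the arcs
    of the base, distinct [k] and [l] separate the levels. *)
Lemma tower_of_arcs alpha n (x b : 'I_n -> R) h :
    (0 < h)%N -> (forall i, 0 < b i <= 1) ->
    (forall (i j : 'I_n) (k l : nat) (u v : R) (m : int), (k < h)%N -> (l < h)%N ->
      x i <= u < x i + b i -> x j <= v < x j + b j ->
      u + k%:R * alpha = v + l%:R * alpha + m%:~R -> i = j /\ k = l) ->
  exists B, union_of_arcs n B /\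
    tower_covers (rotation alpha) B h (h%:R * \sum_i b i).
Proof.
move=> h_gt0 b01 disj; exists (\bigcup_i arc (x i) (b i)).
have arcs_disj : trivIset setT (fun i => arc (x i) (b i)).
  apply/trivIsetP => i j _ _ /eqP ij; apply/seteqP; split=> // _ [[u + <-]].
  rewrite /= in_itv /= => ui /arcP[m uj]; apply: ij.
  have [] // := disj i j 0%N 0%N u (u + m%:~R) (- m) h_gt0 h_gt0 ui uj.
  by rewrite intrN; ring.
have levels_disj :
    trivIset `I_h (tower_level (rotation alpha) (\bigcup_i arc (x i) (b i))).
  apply/trivIsetP => k l /= kh lh /eqP kl; rewrite !tower_level_arcs.
  apply/seteqP; split=> // _ [[i _ [u + <-]] [j _ /arcP[m uj]]].
  rewrite /= in_itv /= => ui; apply: kl.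
  have [] // := disj i j k l (u - k%:R * alpha) (u + m%:~R - l%:R * alpha) (- m) kh lh.
  - by lra.
  - by lra.
  - by rewrite intrN; ring.
split; first by exists (fun i => arc (x i) (b i)); split=> // i; exact: arc_is_arc.
split=> //; rewrite lebesgue_measure_tower// => i.
by have /andP[/ltW-> ->] := b01 i.
Qed.

End Towers.

(** * Two disjoint towers built on a unimodular pair of approximations *)

Section TwoTowers.
Set Implicit Arguments.
Unset Strict Implicit.
Unset Printing Implicit Defensive.
Context {R : realType}.
Implicit Types (d alpha : R).

(* x and y are the coordinates, in the basis (q1, p1), (q2, p2) of Z^2, of the
   pair (k - l, m) attached to a coincidence u + k alpha = v + l alpha + m. *)
Lemma same_tower_disjoint (q1 q2 : nat) d1 d2 (x y : int) :
    0 < d1 -> 0 < d2 -> `|x * q1%:Z + y * q2%:Z| < q2%:Z ->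
    `|x%:~R * d1 - y%:~R * d2| < d1 ->
  x * q1%:Z + y * q2%:Z = 0.
Proof.
move=> d1_gt0 d2_gt0 Kq Kd.
have /andP[Kq1 Kq2] : - q2%:Z < x * q1%:Z + y * q2%:Z < q2%:Z by rewrite -ltr_norml.
clear Kq.
have {Kd} [Kd1 Kd2] : x%:~R * d1 - y%:~R * d2 < d1 /\ - d1 < x%:~R * d1 - y%:~R * d2.
  by move: Kd; rewrite ltr_norml => /andP[].
have [x0|x1|x1] : [\/ x = 0, 1 <= x | x <= -1].
  by case: (ltrgtP x 0) => ?; [constructor 3|constructor 2|constructor 1]; lia.
- subst x; have [y1|[->|y1]] : y <= -1 \/ y = 0 \/ 1 <= y by lia.
  + by exfalso; nia.
  + by rewrite !mul0r.
  + by exfalso; nia.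
(* If [y] is also positive, the integer combination is too large; otherwise the real one is. *)
- have [y1|y0] : 1 <= y \/ y <= 0 by lia.
    by exfalso; nia.
  have x1' : 1 <= x%:~R :> R by rewrite ler1z.
  have y0' : y%:~R <= 0 :> R by rewrite lerz0.
  by exfalso; nra.
- have [y1|y0] : y <= -1 \/ 0 <= y by lia.
    by exfalso; nia.
  have x1' : x%:~R <= -1 :> R by rewrite -[-1]/((-1)%:~R) ler_int.
  have y0' : 0 <= y%:~R :> R by rewrite ler0z.
  by exfalso; nra.
Qed.

(** Levels of the two towers differ by an amount in (-q1, q2), and points of [-d2, 0) and [0, d1) by
    one in (-(d1 + d2), 0). Each of the four sign patterns of (x, y) violates one of these
    bounds. *)
Lemma distinct_towers_disjoint (q1 q2 : nat) d1 d2 (x y : int) :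
    0 < d1 -> 0 < d2 -> - q1%:Z < x * q1%:Z + y * q2%:Z ->
    x * q1%:Z + y * q2%:Z < q2%:Z ->
    - (d1 + d2) < x%:~R * d1 - y%:~R * d2 < 0 -> False.
Proof.
move=> d1_gt0 d2_gt0 Kq1 Kq2 /andP[Kd1 Kd2].
have [x0|x1] : 0 <= x \/ x <= -1 by lia.
- have [y1|y0] : 1 <= y \/ y <= 0 by lia.
    by nia.
  have x0' : 0 <= x%:~R :> R by rewrite ler0z.
  have y0' : y%:~R <= 0 :> R by rewrite lerz0.
  by nra.
- have [y1|y0] : 1 <= y \/ y <= 0 by lia.
    have x1' : x%:~R <= -1 :> R by rewrite -[-1]/((-1)%:~R) ler_int.
    have y1' : 1 <= y%:~R :> R by rewrite ler1z.
    by nra.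
  by nia.
Qed.

(* The circle splits into the arcs [0, d1) + k alpha, k < q2, and
   [-d2, 0) + k alpha, k < q1; each of these two towers is cut into pieces of
   height h. *)
Lemma two_towers alpha (q1 q2 : nat) (p1 p2 : int) (N1 N2 h : nat) :
    let d1 := q1%:R * alpha - p1%:~R in let d2 := p2%:~R - q2%:R * alpha in
    0 < d1 -> 0 < d2 -> q1%:Z * p2 - q2%:Z * p1 = 1 ->
    (0 < h)%N -> (N1 * h <= q2)%N -> (N2 * h <= q1)%N ->
  exists B, union_of_arcs (N1 + N2)%N B /\
    tower_covers (rotation alpha) B h (h%:R * (N1%:R * d1 + N2%:R * d2)).
Proof.
move=> d1 d2 d1_gt0 d2_gt0 det h_gt0 hN1 hN2.
have detR : q1%:R * p2%:~R - q2%:R * p1%:~R = 1 :> R.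
  by rewrite (pmulrn 1 q1) (pmulrn 1 q2) -!intrM -intrB det.
(* The towers have total measure 1, so no arc is wider than 1. *)
have total : q2%:R * d1 + q1%:R * d2 = 1 by apply: etrans detR; rewrite /d1 /d2; ring.
(* Slice [j] starts at level [j * h]. Arcs of the second tower end at the orbit point, hence the
   shift by [d2]. *)
pose x (i : 'I_(N1 + N2)) : R := match fintype.split i with
  | inl j => (j * h)%:R * alpha | inr j => (j * h)%:R * alpha - d2 end.
pose b (i : 'I_(N1 + N2)) := if fintype.split i is inl _ then d1 else d2 : R.
have sum_b : \sum_i b i = N1%:R * d1 + N2%:R * d2.
  rewrite big_split_ord/= /b; congr (_ + _).
    under eq_bigr do rewrite (unsplitK (inl _)).
    by rewrite sumr_const card_ord mulr_natl.
  under eq_bigr do rewrite (unsplitK (inr _)).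
  by rewrite sumr_const card_ord mulr_natl.
rewrite -sum_b; apply: (@tower_of_arcs _ _ _ x) => // [i|].
  have q1_ge0 : 0 <= q1%:R :> R by [].
  have q2_ge0 : 0 <= q2%:R :> R by [].
  rewrite /b; case: (fintype.split i) => j.
    have : 1 <= q2%:R :> R by rewrite ler1n; have := ltn_ord j; nia.
    by move=> *; rewrite d1_gt0/=; nra.
  have : 1 <= q1%:R :> R by rewrite ler1n; have := ltn_ord j; nia.
  by move=> *; rewrite d2_gt0/=; nra.
move=> i i' k l u v m kh lh ui vi' uv.
(* Cramer's rule; the determinant 1 makes the coordinates integers. *)
have basis (A B : nat) (n : int) : exists X Y : int,
    X * q1%:Z + Y * q2%:Z = A%:Z - B%:Z /\
    X%:~R * d1 - Y%:~R * d2 = A%:R * alpha - B%:R * alpha - n%:~R.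
  exists ((A%:Z - B%:Z) * p2 - q2%:Z * n), (q1%:Z * n - (A%:Z - B%:Z) * p1).
  split; first by rewrite -[RHS]mulr1 -[X in _ = _ * X]det; ring.
  rewrite /d1 /d2 !intrB !intrM !intrB -!pmulrn.
  by rewrite -[RHS]mulr1 -[X in _ = _ * X]detR; ring.
have level_lt N (j : 'I_N) k' q : (k' < h)%N -> (N * h <= q)%N -> (j * h + k' < q)%N.
  by have := ltn_ord j; nia.
(* Level [k] of slice [j] is level [j * h + k] of the uncut tower; division by [h] recovers both. *)
have euclid N (j j' : 'I_N) : (j * h + k)%N = (j' * h + l)%N -> j = j' /\ k = l.
  move=> E; have kl : k = l by rewrite -(modn_small kh) -(modn_small lh) -(modnMDl j) E modnMDl.
  split=> //; apply/val_inj/eqP; rewrite -(eqn_pmul2r h_gt0); apply/eqP => /=; lia.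
have ord_split (j : 'I_(N1 + N2)) : j = unsplit (fintype.split j) by rewrite splitK.
move: ui vi'; rewrite /x /b.
case ei: (fintype.split i) => [j|j]; case ei': (fintype.split i') => [j'|j'] => ui vi';
  have jq := level_lt _ j _ _ kh; have jq' := level_lt _ j' _ _ lh.
- have {}jq := jq _ hN1; have {}jq' := jq' _ hN1.
  have [X [Y [XY XYd]]] := basis (j * h + k)%N (j' * h + l)%N m.
  have := @same_tower_disjoint q1 q2 d1 d2 X Y d1_gt0 d2_gt0.
  rewrite XY XYd !natrD => K0; have [|jj' ->] := euclid _ j j'.
    suff : (j * h + k)%N%:Z - (j' * h + l)%N%:Z = 0 by lia.
    by apply: K0; [lia|rewrite ltr_norml; lra].
  by rewrite (ord_split i) (ord_split i') ei ei' jj'.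
- have {}jq := jq _ hN1; have {}jq' := jq' _ hN2.
  have [X [Y [XY XYd]]] := basis (j * h + k)%N (j' * h + l)%N m.
  have := @distinct_towers_disjoint q1 q2 d1 d2 X Y d1_gt0 d2_gt0.
  by rewrite XY XYd !natrD => K0; exfalso; apply: K0; [lia|lia|lra].
(* The coincidence is read backwards, with [- m], so that the point of the first tower comes
   first. *)
- have {}jq := jq _ hN2; have {}jq' := jq' _ hN1.
  have [X [Y [XY XYd]]] := basis (j' * h + l)%N (j * h + k)%N (- m).
  have := @distinct_towers_disjoint q1 q2 d1 d2 X Y d1_gt0 d2_gt0.
  by rewrite XY XYd !natrD intrN => K0; exfalso; apply: K0; [lia|lia|lra].
(* Inside the second tower the two pairs exchange roles, and so do [X] and [Y]. *)
- have {}jq := jq _ hN2; have {}jq' := jq' _ hN2.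
  have [X [Y [XY XYd]]] := basis (j * h + k)%N (j' * h + l)%N m.
  have := @same_tower_disjoint q2 q1 d2 d1 Y X d2_gt0 d1_gt0.
  rewrite distrC XYd addrC XY !natrD => K0; have [|jj' ->] := euclid _ j j'.
    suff : (j * h + k)%N%:Z - (j' * h + l)%N%:Z = 0 by lia.
    by apply: K0; [lia|rewrite ltr_norml; lra].
  by rewrite (ord_split i) (ord_split i') ei ei' jj'.
Qed.

End TwoTowers.

(** * Covering numbers: changing the number of arcs, upper and lower bounds *)

Section Covering.
Set Implicit Arguments.
Unset Strict Implicit.
Unset Printing Implicit Defensive.
Context {R : realType}.
Implicit Types (b c z alpha : R).

Lemma arc_halves c b : arc c b = arc c (b / 2) `|` arc (c + b / 2) (b / 2).
Proof.
apply/seteqP; split=> [_ [x + <-]|_ [] [x + <-]]; rewrite /= in_itv /= => xI.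
- have [xl|xr] := ltP x (c + b / 2).
    by left; apply/arcP; exists 0; lra.
  by right; apply/arcP; exists 0; lra.
- by apply/arcP; exists 0; lra.
- by apply/arcP; exists 0; lra.
Qed.

Lemma arc_halves_disjoint c b :
  b <= 1 -> arc c (b / 2) `&` arc (c + b / 2) (b / 2) = set0.
Proof.
move=> b1; apply/seteqP; split=> // _ [[x + <-] /arcP[m xr]].
rewrite /= in_itv /= => xl.
have : (0 : int)%:~R < m%:~R :> R by lra.
have : m%:~R < (1 : int)%:~R :> R by lra.
by rewrite !ltr_int; lia.
Qed.

Lemma union_of_arcsP n (B : set R) : union_of_arcs n B ->
  exists x b : 'I_n -> R, [/\ forall i, 0 < b i <= 1,
    trivIset setT (fun i => arc (x i) (b i)) & B = \bigcup_i arc (x i) (b i)].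
Proof.
move=> [I [I_arc I_disj ->]].
have /choice[xb xbP] i : exists xb : R * R, 0 < xb.2 <= 1 /\ I i = arc xb.1 xb.2.
  by have [c [b [_ b01 ->]]] := I_arc i; exists (c, b).
have IE : I = fun i => arc (xb i).1 (xb i).2 by apply/funext => i; have [] := xbP i.
exists (fun i => (xb i).1), (fun i => (xb i).2); rewrite -IE; split=> // i.
by have [] := xbP i.
Qed.

(** As adjacent arcs are allowed, halving the first arc adds one arc without changing [B].
    Constructions with fewer than [n] arcs thus serve for [n]. *)
Lemma union_of_arcsS n (B : set R) :
  union_of_arcs n.+1 B -> union_of_arcs n.+2 B.
Proof.
move=> [I [I_arc I_disj ->]].
have [c [b [c01 b01 I0]]] := I_arc ord0; rewrite -/(arc c b) in I0.
(* [f] sends a new arc to the old one containing it; the new arcs 0 and 1 both come from the old arc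
   0. *)
pose f (i : 'I_n.+2) := odflt ord0 (unlift ord0 i).
pose J (i : 'I_n.+2) := if i == ord0 then arc c (b / 2) else
  if f i == ord0 then arc (c + b / 2) (b / 2) else I (f i).
have f0 : f ord0 = ord0 by rewrite /f unlift_none.
have fS j : f (lift ord0 j) = j by rewrite /f liftK.
have J0 : J ord0 = arc c (b / 2) by rewrite /J eqxx.
have J1 : J (lift ord0 ord0) = arc (c + b / 2) (b / 2) by rewrite /J fS eqxx.
have JS j : j != ord0 -> J (lift ord0 j) = I j.
  by move=> /negPf j0; rewrite /J fS j0.
have JI i : J i `<=` I (f i).
  rewrite /J; have [->|_] := eqVneq i ord0; first by rewrite f0 I0 (arc_halves c b); left.
  by have [->|_] := eqVneq (f i) ord0; rewrite // I0 (arc_halves c b); right.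
exists J; split.
- move=> i; rewrite /J; do 2?case: ifP => _; try by apply: arc_is_arc; lra.
  exact: I_arc.
- apply/trivIsetP => i j _ _ ij; have [fij|fij] := eqVneq (f i) (f j); last first.
    move/trivIsetP: I_disj => /(_ _ _ Logic.I Logic.I fij)/seteqP[+ _] => I_disj.
    by apply/seteqP; split=> // y [yi yj]; apply: (I_disj y); split; exact: JI.
  have half : J ord0 `&` J (lift ord0 ord0) = set0.
    by rewrite J0 J1 arc_halves_disjoint//; case/andP: b01.
  have [i' i0|i0] := unliftP ord0 i; have [j' j0|j0] := unliftP ord0 j;
    move: ij fij; rewrite ?i0 ?j0 ?fS ?f0.
  + by move=> /eqP + E; rewrite E.
  + by move=> _ ->; rewrite setIC.
  + by move=> _ <-.
  + by rewrite eqxx.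
- apply/seteqP; split=> y [i _].
    have [->|i0] := eqVneq i ord0.
      rewrite I0 (arc_halves c b) => -[yl|yr].
        by exists ord0; rewrite ?J0.
      by exists (lift ord0 ord0); rewrite ?J1.
    by exists (lift ord0 i); rewrite ?JS.
  by move=> /JI; exists (f i).
Qed.

Lemma union_of_arcs_le m n (B : set R) : (0 < m)%N -> (m <= n)%N ->
  union_of_arcs m B -> union_of_arcs n B.
Proof.
move=> m_gt0 /subnK <-; elim: (n - m)%N => // k IH /IH.
by rewrite addSn -(prednK m_gt0) addnS; exact: union_of_arcsS.
Qed.

Lemma covered_measure alpha n (B : set R) h z :
    union_of_arcs n B -> tower_covers (rotation alpha) B h z ->
  z <= 1 /\ exists x b : 'I_n -> R, [/\ forall i, 0 < b i <= 1,
    B = \bigcup_i arc (x i) (b i) & z <= h%:R * \sum_i b i].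
Proof.
move=> /union_of_arcsP[x [b [b01 arcs_disj ->]]] [levels_disj].
have b01' i : 0 <= b i <= 1 by have /andP[/ltW-> ->] := b01 i.
rewrite lebesgue_measure_tower// => zE; split; last by exists x, b.
rewrite -lee_fin (le_trans zE)//.
rewrite -(@lebesgue_measure_tower _ alpha _ x)//.
have -> : 1%:E = lebesgue_measure (`[0, 1[%classic : set R).
  by rewrite lebesgue_measure_itv/= lte_fin ltr01 oppr0 adde0.
apply: le_measure; rewrite ?inE//.
  apply: fin_bigcup_measurable => // k _; rewrite tower_level_arcs.
  by apply: fin_bigcup_measurable => // i _; exact: measurable_arc.
by move=> y [k _]; rewrite tower_level_arcs => -[i _]; exact: arc_sub.
Qed.

Definition achieves alpha n z := forall h0 : nat, (0 < h0)%N ->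
  exists h B, [/\ (h0 <= h)%N, union_of_arcs n B & tower_covers (rotation alpha) B h z].

Lemma achieves_le1 alpha n z : achieves alpha n z -> z <= 1.
Proof. by move=> /(_ 1%N isT)[h [B [_ nB /(covered_measure nB)[]]]]. Qed.

Lemma achieves_le_covering_number alpha n z :
  achieves alpha n z -> z <= covering_number n (rotation alpha).
Proof. by apply: ub_le_sup; exists 1 => y; exact: achieves_le1. Qed.

(** The condition [0 <= z] covers the convention that [sup] of the empty set is 0. *)
Lemma covering_number_le alpha n z : 0 <= z ->
  (forall y, achieves alpha n y -> y <= z) -> covering_number n (rotation alpha) <= z.
Proof.
move=> z_ge0 ubz; rewrite /covering_number; set S := (X in sup X).
have [->|/set0P S0] := eqVneq S set0; first by rewrite sup0.
exact: ge_sup.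
Qed.

Lemma covering_number_ge0 alpha n : 0 <= covering_number n (rotation alpha).
Proof.
rewrite /covering_number; set S := (X in sup X).
have [->|/set0P[z z_ach]] := eqVneq S set0; first by rewrite sup0.
(* The towers that witness some [z] also witness 0. *)
apply: achieves_le_covering_number => h0 /z_ach[h [B [h0h nB [B_disj _]]]].
by exists h, B; split=> //; split.
Qed.

(** Modulo 1, level [q] is the base rotated by [d = q alpha - p]. An arc wider than |d| would meet
    it: the start of one of the two arcs lies in the other. *)
Lemma one_arc_tower_bound alpha (B : set R) h z (q : nat) (p : int) :
    (0 < q < h)%N -> union_of_arcs 1 B -> tower_covers (rotation alpha) B h z ->
  z <= h%:R * `|q%:R * alpha - p%:~R|.
Proof.
move=> /andP[q_gt0 qh] B1 zB; have [_ [x [b [b01 BE zE]]]] := covered_measure B1 zB.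
rewrite (le_trans zE)// ler_wpM2l// big_ord1 leNgt; apply/negP => d_lt.
have /seteqP[+ _] : tower_level (rotation alpha) B 0 `&` tower_level (rotation alpha) B q = set0.
  have [/trivIsetP levels_disj _] := zB.
  by apply: levels_disj; rewrite /=; lia.
rewrite BE !tower_level_arcs; set d := q%:R * alpha - p%:~R in d_lt.
have [d_ge0|d_lt0] := leP 0 d.
  move: d_lt; rewrite ger0_norm// => d_lt /(_ (mod1 (x ord0 + d))); apply; split.
    by exists ord0 => //; apply/arcP; exists 0; have := b01 ord0; lra.
  by exists ord0 => //; apply/arcP; exists p; have := b01 ord0; rewrite /d; lra.
move: d_lt; rewrite ltr0_norm// => d_lt /(_ (mod1 (x ord0))); apply; split.
  by exists ord0 => //; apply/arcP; exists 0; have := b01 ord0; lra.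
by exists ord0 => //; apply/arcP; exists p; have := b01 ord0; rewrite /d in d_lt d_lt0; lra.
Qed.

End Covering.

(** * Continued fractions: denominators, approximation errors and the resulting towers *)

Section ContinuedFraction.
Set Implicit Arguments.
Unset Strict Implicit.
Unset Printing Implicit Defensive.

(* With the usual convergents p_i / q_i, cf_den a k is q_(k-1) and cf_num a k is
   p_(k-1), so that the recursion starts at q_(-1) = 0 and p_(-1) = 1. *)
Fixpoint cf_den (a : nat -> int) (k : nat) : nat :=
  match k with
  | 0 => 0
  | k1.+1 => match k1 with
    | 0 => 1
    | k2.+1 => `|a k1| * cf_den a k1 + cf_den a k2
    end
  end%N.

Fixpoint cf_num (a : nat -> int) (k : nat) : int :=
  match k with
  | 0 => 1
  | k1.+1 => match k1 with
    | 0 => a 0%N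
    | k2.+1 => a k1 * cf_num a k1 + cf_num a k2
    end
  end.

Lemma cf_denSS a k : cf_den a k.+2 = (`|a k.+1| * cf_den a k.+1 + cf_den a k)%N.
Proof. by []. Qed.

Lemma cf_numSS a k : cf_num a k.+2 = a k.+1 * cf_num a k.+1 + cf_num a k.
Proof. by []. Qed.

Context {R : realType}.
Implicit Types x alpha : R.

Fixpoint complete_quotient x (a : nat -> int) (k : nat) : R :=
  if k is k1.+1 then (complete_quotient x a k1 - (a k1)%:~R)^-1 else x.

Lemma irrational_inv_subz x (m : int) : irrational x -> irrational (x - m%:~R)^-1.
Proof.
move=> irr_x [r _ rE]; apply: irr_x; exists (m%:~R + r^-1) => //.
by rewrite rmorphD/= ratr_int fmorphV/= rE invrK; lra.
Qed.

Lemma irrational_neqz x (m : int) : irrational x -> x != m%:~R.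
Proof.
by move=> irr_x; apply/eqP => xm; apply: irr_x; exists m%:~R; rewrite // ratr_int.
Qed.

Lemma cf_convergent_ge1 (a : nat -> int) n :
  (forall i, 0 < a i) -> 1 <= cf_convergent R a n.
Proof.
elim: n a => [|n IH] a a_gt0 /=; first by rewrite ler1z; have := a_gt0 0%N; lia.
have a01 : 1 <= (a 0%N)%:~R :> R by rewrite ler1z; have := a_gt0 0%N; lia.
have : 0 < (cf_convergent R (fun i => a i.+1) n)^-1.
  by rewrite invr_gt0 (lt_le_trans ltr01)// IH.
by lra.
Qed.

(** The shifted convergents are the inverses of the original ones minus [a 0]. Irrationality makes
    the inverse continuous at the limit, and makes the limit bound [1 <= y] strict. *)
Lemma cf_shift x (a : nat -> int) : irrational x -> is_cf_expansion x a ->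
  let y := (x - (a 0%N)%:~R)^-1 in
  [/\ irrational y, is_cf_expansion y (fun i => a i.+1) & 1 < y].
Proof.
move=> irr_x [a_gt0 a_cvg] y.
have irr_y : irrational y by exact: irrational_inv_subz.
have shift_cvg : cf_convergent R (fun i => a i.+1) n @[n --> \oo] --> y.
  rewrite (_ : (fun n => _) = (fun n => (cf_convergent R a n.+1 - (a 0%N)%:~R)^-1)).
    apply: cvgV; first by rewrite subr_eq0 irrational_neqz.
    by apply: cvgB; [rewrite (cvg_shiftS (cf_convergent R a))|exact: cvg_cst].
  by apply/funext => n /=; rewrite addrC addKr invrK.
split=> //; first by split=> // i _; exact: a_gt0.
rewrite lt_neqAle eq_sym (irrational_neqz 1)//=.
rewrite -(cvg_lim _ shift_cvg)//; apply: limr_ge; first by apply/cvg_ex; exists y.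
by apply: nearW => n; apply: cf_convergent_ge1 => i; exact: a_gt0.
Qed.

Context (alpha : R) (a : nat -> int).
Hypothesis alpha_irr : irrational alpha.
Hypothesis alpha_cf : is_cf_expansion alpha a.

Let theta := complete_quotient alpha a.

Lemma complete_quotient_cf k :
  irrational (theta k) /\ is_cf_expansion (theta k) (fun i => a (k + i)%N).
Proof.
elim: k => [|k [IH1 IH2]]; first by [].
have [irr cf _] := cf_shift IH1 IH2; rewrite addn0 in irr cf.
split=> //=; rewrite /theta/= -/theta.
by rewrite (_ : (fun i => _) = (fun i => a (k + i.+1)%N))//; apply/funext => i; rewrite addnS.
Qed.

Lemma complete_quotient_gt1 k : 1 < theta k.+1.
Proof.
have [irr cf] := complete_quotient_cf k.
by have [_ _] := cf_shift irr cf; rewrite addn0.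
Qed.

Lemma a_absz k : (0 < k)%N -> (`|a k|%N%:Z = a k) /\ (0 < `|a k|)%N.
Proof. by case: alpha_cf => a_gt0 _ /a_gt0; lia. Qed.

Lemma cf_den_gt0 k : (0 < cf_den a k.+1)%N.
Proof. by elim: k => // k IH; rewrite cf_denSS; have [_] := @a_absz k.+1 isT; nia. Qed.

Lemma cf_den_mono k : (cf_den a k <= cf_den a k.+1)%N.
Proof. by case: k => // k; rewrite cf_denSS; have [_] := @a_absz k.+1 isT; nia. Qed.

Lemma cf_den_ge k : (k <= cf_den a k.+1)%N.
Proof.
elim: k => // -[|k] IH; first exact: cf_den_gt0.
rewrite cf_denSS; have [_] := @a_absz k.+2 isT; have := cf_den_gt0 k; nia.
Qed.

(** Bounded partial quotients keep consecutive denominators comparable, which will bound the number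
    of slices. *)
Lemma cf_den_leS (s : nat) k : (forall i, (0 < i)%N -> a i <= s%:Z) ->
  (cf_den a k.+2 <= s.+1 * cf_den a k.+1)%N.
Proof.
move=> /(_ k.+1 isT); have [aE _] := @a_absz k.+1 isT.
by rewrite cf_denSS -aE lez_nat; have := cf_den_mono k; nia.
Qed.

Lemma cf_det k :
  (cf_den a k)%:Z * cf_num a k.+1 - (cf_den a k.+1)%:Z * cf_num a k = - (-1) ^+ k.
Proof.
elim: k => [|k IH]; first by rewrite mul0r mul1r sub0r.
rewrite cf_denSS cf_numSS exprS PoszD PoszM (a_absz _).1//.
by rewrite mulN1r opprK -[RHS]opprK -IH; ring.
Qed.

(** The sign makes this the absolute error of the convergent with denominator [cf_den a k]; it
    starts at 1. *)
Definition cf_err k : R := (-1) ^+ k.+1 * ((cf_den a k)%:R * alpha - (cf_num a k)%:~R).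

(** The errors obey e_(k+2) = e_k - a_(k+1) e_(k+1), while theta_(k+1) - a_(k+1) = 1 / theta_(k+2);
    induction combines the two. Positivity of the errors follows. *)
Lemma cf_errE k : cf_err k = theta k.+1 * cf_err k.+1.
Proof.
have th_gt0 i : 0 < theta i.+1 by exact: lt_trans (complete_quotient_gt1 i).
have th_rec i : theta i = (a i)%:~R + (theta i.+1)^-1.
  by rewrite /theta/= invrK; lra.
elim: k => [|k IH].
  rewrite /cf_err/= mul0r mul1r sub0r expr1 mulrNN mulr1 expr2 mulrNN !mul1r.
  by rewrite mulVf// subr_eq0 irrational_neqz.
have aR : (`|a k.+1|%N)%:R = (a k.+1)%:~R :> R by rewrite pmulrn (a_absz _).1.
have rec : cf_err k.+2 = cf_err k - (a k.+1)%:~R * cf_err k.+1.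
  by rewrite /cf_err cf_denSS cf_numSS natrD natrM intrD intrM aR !exprS; ring.
have -> : cf_err k.+2 = (theta k.+2)^-1 * cf_err k.+1.
  by rewrite rec IH -mulrBl (th_rec k.+1) addrC addKr.
by rewrite mulVKf ?gt_eqF.
Qed.

Lemma cf_err0 : cf_err 0 = 1.
Proof. by rewrite /cf_err/= mul0r expr1 sub0r mulrNN mulr1. Qed.

Lemma cf_err_gt0 k : 0 < cf_err k.
Proof.
elim: k => [|k]; first by rewrite cf_err0.
by rewrite cf_errE pmulr_rgt0// (lt_trans _ (complete_quotient_gt1 k)).
Qed.

(** The determinant identity, read as the total measure of the two towers. *)
Lemma cf_area k :
  (cf_den a k.+1)%:R * cf_err k + (cf_den a k)%:R * cf_err k.+1 = 1.
Proof.
have := congr1 (fun m : int => m%:~R : R) (cf_det k).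
rewrite /cf_err !intrD !intrN !intrM -!pmulrn => det.
have sgn2 : (-1) ^+ k * (-1) ^+ k = 1 :> R by rewrite -exprMn mulrNN mulr1 expr1n.
rewrite !exprS.
transitivity (- (-1) ^+ k * ((cf_den a k)%:R * (cf_num a k.+1)%:~R -
    (cf_den a k.+1)%:R * (cf_num a k)%:~R) : R); first ring.
by rewrite det rmorphXn/= intrN mulrNN.
Qed.

Lemma cf_tower k (N1 N2 h : nat) : (0 < h)%N ->
    (N1 * h <= cf_den a k.+1)%N -> (N2 * h <= cf_den a k)%N ->
  exists B, union_of_arcs (N1 + N2)%N B /\ tower_covers (rotation alpha) B h
    (h%:R * (N1%:R * cf_err k + N2%:R * cf_err k.+1)).
Proof.
move=> h_gt0 hN1 hN2; have e_gt0 := cf_err_gt0 k; have e'_gt0 := cf_err_gt0 k.+1.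
have := cf_det k; rewrite -signr_odd.
move: e_gt0 e'_gt0; rewrite /cf_err !exprS -signr_odd.
(* The parity of [k] decides which convergent lies below [alpha], hence which tower comes first. *)
case: (odd k); rewrite !(expr0, expr1, mulr1, mul1r, mulN1r, opprK, opprB) => e_gt0 e'_gt0 det.
  exact: two_towers.
rewrite addnC [X in _ * X]addrC; apply: two_towers => //.
by rewrite -opprB det opprK.
Qed.

Lemma one_arc_cf_bound k (B : set R) h z : (0 < cf_den a k < h)%N ->
  union_of_arcs 1 B -> tower_covers (rotation alpha) B h z -> z <= h%:R * cf_err k.
Proof.
move=> kh B1 /(one_arc_tower_bound (cf_num a k) kh B1).
by rewrite -(gtr0_norm (cf_err_gt0 k)) /cf_err normrM normrX normrN1 expr1n mul1r.
Qed.

Lemma bounded_type_achieves (s N n : nat) : (0 < N)%N ->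
    (forall i, (0 < i)%N -> a i <= s%:Z) -> (2 * N * s.+2 <= n)%N ->
  achieves alpha n (1 - N%:R^-1).
Proof.
(* This [k] gives [N * h0 <= q], hence [h0 <= h]. *)
move=> N_gt0 a_le Nn h0 h0_gt0; pose k := (N * h0)%N; pose q := cf_den a k.+1.
pose h := (q %/ N)%N.
have h0h : (h0 <= h)%N by rewrite leq_divRL// mulnC cf_den_ge.
have h_gt0 : (0 < h)%N by exact: leq_trans h0h.
have qh : (q <= 2 * N * h)%N.
  by have := divn_eq q N; have := ltn_pmod q N_gt0; rewrite -/h; nia.
have q'q : (cf_den a k.+2 <= s.+1 * q)%N.
  exact: cf_den_leS.
pose N1 := (cf_den a k.+2 %/ h)%N; pose N2 := (q %/ h)%N.
have [B [B_arcs [B_disj B_cov]]] := @cf_tower k.+1 N1 N2 h h_gt0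
  (leq_trunc_div _ _) (leq_trunc_div _ _).
exists h, B; split => //.
  apply: union_of_arcs_le B_arcs.
    by rewrite addn_gt0 orbC divn_gt0// leq_div.
  (* From q <= 2 N h and q' <= (s + 1) q there are at most 2 N (s + 1) + 2 N slices. *)
  have N1_le : (N1 <= 2 * N * s.+1)%N by rewrite /N1 -(mulnK (2 * N * s.+1) h_gt0) leq_div2r//; nia.
  have N2_le : (N2 <= 2 * N)%N by rewrite /N2 -(mulnK (2 * N) h_gt0) leq_div2r.
  by nia.
split=> //; apply: le_trans B_cov; rewrite lee_fin.
have e_gt0 := cf_err_gt0 k.+1; have e'_gt0 := cf_err_gt0 k.+2.
have area := cf_area k.+1; rewrite -/q in area.
have r1 : (cf_den a k.+2)%:R <= N1%:R * h%:R + h%:R :> R.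
  by rewrite -natrM -natrD ler_nat {1}(divn_eq (cf_den a k.+2) h) leq_add2l ltnW// ltn_mod.
have r2 : q%:R <= N2%:R * h%:R + h%:R :> R.
  by rewrite -natrM -natrD ler_nat {1}(divn_eq q h) leq_add2l ltnW// ltn_mod.
have hq : h%:R <= N%:R^-1 * q%:R :> R.
  by rewrite ler_pdivlMl ?ltr0n// -natrM ler_nat mulnC leq_trunc_div.
have qq' : q%:R <= (cf_den a k.+2)%:R :> R by rewrite ler_nat cf_den_mono.
(* Each tower loses fewer than [h] levels; moreover h <= q / N, and q times the sum of the errors is
   at most the total area 1. *)
have loss : h%:R * (cf_err k.+1 + cf_err k.+2) <= N%:R^-1.
  apply: (@le_trans _ _ (N%:R^-1 * q%:R * (cf_err k.+1 + cf_err k.+2))).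
    by rewrite ler_pM2r// addr_gt0.
  by rewrite -mulrA ler_piMr ?invr_ge0//; nra.
by nra.
Qed.

End ContinuedFraction.

(** * Constant partial quotients *)

Section ConstantQuotients.
Set Implicit Arguments.
Unset Strict Implicit.
Unset Printing Implicit Defensive.
Context {R : realType} (alpha : R) (a : nat -> int) (s : nat).
Hypothesis alpha_irr : irrational alpha.
Hypothesis alpha_cf : is_cf_expansion alpha a.
Hypothesis a_const : forall i, a i = s%:Z.

(** Shifting a constant sequence does nothing, and limits are unique. *)
Lemma complete_quotient_const k : complete_quotient alpha a k = alpha.
Proof.
have [_ [_ cf_k]] := complete_quotient_cf alpha_irr alpha_cf k.
rewrite (_ : (fun i => _) = a) in cf_k; last by apply/funext => i; rewrite !a_const.
have [_ cf] := alpha_cf.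
by rewrite -(cvg_lim _ cf_k)// (cvg_lim _ cf).
Qed.

Lemma const_gt1 : 1 < alpha.
Proof. by rewrite -(complete_quotient_const 1) complete_quotient_gt1. Qed.

Lemma const_fixpoint : alpha = s%:R + alpha^-1.
Proof.
have := complete_quotient_const 1; rewrite /= a_const => alE.
by rewrite -{2}alE invrK -pmulrn; lra.
Qed.

Lemma const_err k : cf_err alpha a k.+1 = cf_err alpha a k / alpha.
Proof.
have al_gt0 := lt_trans ltr01 const_gt1.
by rewrite (cf_errE alpha_irr alpha_cf k) complete_quotient_const mulrAC divff ?mul1r// gt_eqF.
Qed.

(** The difference of the two sides without the 1 starts at 1 and is multiplied by -1 / alpha at
    each step. *)
Lemma const_den_le k : (cf_den a k.+1)%:R <= alpha * (cf_den a k)%:R + 1.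
Proof.
have al_gt1 := const_gt1; have al_gt0 := lt_trans ltr01 al_gt1.
suff : `|(cf_den a k.+1)%:R - alpha * (cf_den a k)%:R| <= 1 by rewrite ler_norml; lra.
elim: k => [|k IH]; first by rewrite mulr0 subr0 normr1.
have -> : (cf_den a k.+2)%:R - alpha * (cf_den a k.+1)%:R =
    - alpha^-1 * ((cf_den a k.+1)%:R - alpha * (cf_den a k)%:R).
  rewrite cf_denSS a_const natrD natrM mulrBr mulrA !mulNr mulVf ?gt_eqF//.
  have -> : alpha^-1 = alpha - s%:R by have := const_fixpoint; lra.
  by rewrite /=; ring.
rewrite normrM normrN (@gtr0_norm _ alpha^-1) ?invr_gt0//.
apply: le_trans IH; rewrite ler_piMl//.
by rewrite invf_le1// ltW.
Qed.

(** A high one-arc tower is compared with the sliced towers at the denominators around its height: z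
    <= q e for the one arc, against nearly q e (N1 + N2 / alpha) / A for the slices. [A] stands for
    a power of [alpha]. *)
Lemma const_achieves (A eps z : R) (N1 N2 n : nat) :
    (0 < N1)%N -> (N1 + N2 <= n)%N -> N1%:R <= A -> N2%:R <= A / alpha ->
    0 < eps < 1 -> achieves alpha 1 z ->
  achieves alpha n ((1 - eps) * (z * ((N1%:R + N2%:R / alpha) / A))).
Proof.
move=> N1_gt0 Nn N1A N2A eps01 z_ach h0 h0_gt0.
have al_gt1 := const_gt1; have al_gt0 := lt_trans ltr01 al_gt1.
have A_ge1 : 1 <= A by rewrite (le_trans _ N1A)// ler1n.
have A_gt0 : 0 < A by exact: lt_le_trans A_ge1.
have eps_gt0 : 0 < eps by case/andP: eps01.
(* The first two summands will force [h0 <= H], the last one [1 + A <= eps * q]. *)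
pose M := (Num.truncn (A * (h0%:R + 1) + 1 + (1 + A) / eps)).+1.
have ltM : A * (h0%:R + 1) + 1 + (1 + A) / eps < M%:R by exact: truncnS_gt.
have [h [B [Mh B1 zB]]] := z_ach (maxn M 2) (leq_trans (isT : (0 < 2)%N) (leq_maxr M 2)).
have {}Mh : (M <= h)%N /\ (2 <= h)%N by rewrite geq_max in Mh; exact/andP.
have ex_k : exists k, (h <= cf_den a k)%N.
  by exists h.+1; exact: cf_den_ge alpha_cf h.
(* Minimality gives q' < h <= q; [2 <= h] excludes the initial denominators 0 and 1. *)
case: (ex_minnP ex_k) => -[|[|k]] hk k_min; try by move: hk => /=; lia.
have hk' : (cf_den a k.+1 < h)%N.
  by rewrite ltnNge; apply/negP => /k_min; rewrite ltnn.
have z_le := one_arc_cf_bound alpha_irr alpha_cf.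
have {}z_le : z <= h%:R * cf_err alpha a k.+1.
  by apply: z_le B1 zB; rewrite hk' (cf_den_gt0 alpha_cf).
have den_le := const_den_le k.+1.
have e_gt0 := cf_err_gt0 alpha_irr alpha_cf k.+1.
set q := cf_den a k.+2 in hk den_le; set q' := cf_den a k.+1 in hk' den_le.
set e := cf_err _ _ _ in z_le e_gt0.
have Mq : M%:R <= q%:R :> R by rewrite ler_nat (leq_trans _ hk) ?Mh.1.
have {}z_le : z <= q%:R * e by rewrite (le_trans z_le)// ler_pM2r// ler_nat.
(* The [- 1] absorbs the additive error in q <= alpha q' + 1, so that [N2] slices fit into q'
   levels. *)
pose H := Num.truncn ((q%:R - 1) / A).
have q_ge : A * (h0%:R + 1) + 1 + (1 + A) / eps < q%:R by exact: lt_le_trans Mq.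
have eps_ge0 : 0 <= (1 + A) / eps by rewrite divr_ge0 ?ltW//; lra.
have Ah0 : 0 <= A * (h0%:R + 1) by rewrite mulr_ge0 ?ltW.
have /andP[H_le H_gt] : H%:R <= (q%:R - 1) / A < H.+1%:R.
  by apply: truncn_itv; rewrite divr_ge0 ?ltW//; lra.
have {}H_le : H%:R * A <= q%:R - 1 by rewrite -ler_pdivlMr.
have {}H_gt : q%:R - 1 < (H%:R + 1) * A by rewrite natr1 -ltr_pdivrMr.
have h0H : (h0 <= H)%N.
  have : h0%:R < H%:R :> R by nra.
  by rewrite ltr_nat; exact: ltnW.
have eps_q : 1 + A <= eps * q%:R.
  have : (1 + A) / eps <= q%:R by lra.
  by rewrite ler_pdivrMr// mulrC.
have H_ge0 : 0 <= H%:R :> R by [].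
have hN1 : (N1 * H <= q)%N.
  by rewrite -(ler_nat R) natrM; nra.
have hN2 : (N2 * H <= q')%N.
  rewrite -(ler_nat R) natrM -(ler_pM2l al_gt0).
  have : alpha * N2%:R <= A by rewrite mulrC -ler_pdivlMr.
  by nra.
have [C [C_arcs [C_disj C_cov]]] := cf_tower alpha_irr alpha_cf
  (leq_trans h0_gt0 h0H) hN1 hN2.
exists H, C; split=> //.
  by apply: union_of_arcs_le C_arcs => //; rewrite addn_gt0 N1_gt0.
split=> //; apply: le_trans C_cov; rewrite lee_fin (const_err k.+1) -/e.
set W := N1%:R + N2%:R / alpha.
have W_gt0 : 0 < W by rewrite ltr_wpDr ?ltr0n// divr_ge0// ltW.
have -> : N1%:R * e + N2%:R * (e / alpha) = e * W by rewrite /W; ring.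
have -> : (1 - eps) * (z * (W / A)) = (1 - eps) * z / A * W by ring.
rewrite mulrA ler_pM2r// ler_pdivrMr//.
apply: (@le_trans _ _ ((1 - eps) * (q%:R * e))); first by rewrite ler_wpM2l//; lra.
have -> : H%:R * e * A = (H%:R * A) * e by ring.
by rewrite mulrA ler_pM2r//; nra.
Qed.

End ConstantQuotients.

(** * Comparison of the stated floor expression with the slice count *)

Section FloorBound.
Set Implicit Arguments.
Unset Strict Implicit.
Unset Printing Implicit Defensive.
Context {R : realType} (alpha : R) (s : nat).
Hypothesis s_gt0 : (0 < s)%N.
Hypothesis alpha_gt1 : 1 < alpha.
Hypothesis alphaE : alpha = s%:R + alpha^-1.

Lemma const_floor : Num.floor alpha = s%:Z.
Proof.
have inv_gt0 : 0 < alpha^-1 by rewrite invr_gt0 (lt_trans ltr01).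
have inv_lt1 : alpha^-1 < 1 by rewrite invf_lt1 ?(lt_trans ltr01).
apply: floor_def; rewrite intrD -(pmulrn 1 s).
have alE := alphaE.
by apply/andP; split; lra.
Qed.

Lemma floor_pow_bound j :
  (Num.floor (alpha ^+ j.+1))%:~R * s%:R + (Num.floor (alpha ^+ j))%:~R <=
  alpha ^+ 2 * ((Num.floor (alpha ^+ j))%:~R
                + (Num.floor (alpha ^ (j%:Z - 1)))%:~R / alpha).
Proof.
have al_gt0 : 0 < alpha by exact: lt_trans alpha_gt1.
have s_ge1 : 1 <= s%:R :> R by rewrite ler1n.
have alM : alpha * alpha = s%:R * alpha + 1.
  by rewrite {2}alphaE mulrDr divff ?gt_eqF// mulrC.
set N := (Num.floor (alpha ^+ j))%:~R; set N' := (Num.floor (alpha ^ _))%:~R.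
have /andP[N_le N_gt] : N <= alpha ^+ j < N + 1.
  by have := floor_itv (alpha ^+ j); rewrite intrD.
have floorS : (Num.floor (alpha ^+ j.+1))%:~R <= alpha * alpha ^+ j.
  by rewrite -exprS floor_le.
(* By alpha^2 = s alpha + 1, only the fractional part of alpha^j remains to be controlled. *)
suff frac : s%:R * (alpha ^+ j - N) <= N'.
  have -> : alpha ^+ 2 * (N + N' / alpha) = alpha * alpha * N + alpha * N' * (alpha / alpha).
    by ring.
  rewrite divff ?gt_eqF// mulr1 alM.
  by nra.
(* The fractional part is 0 for j = 0 and 1 / alpha <= 1 / s for j = 1. Beyond that it is below 1,
   while N' is at least floor(alpha) = s. *)
rewrite {}/N' {}/N in N_gt {N_le} *; clear floorS; case: j N_gt => [|[|j]] N_gt.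
- by rewrite expr0 floor1 subrr mulr0 ler0z floor_ge0 exprz_ge0// ltW.
- rewrite expr1 const_floor -pmulrn subrr expr0z floor1.
  have -> : alpha - s%:R = alpha^-1 by have := alphaE; lra.
  have inv_gt0 : 0 < alpha^-1 by rewrite invr_gt0.
  by rewrite ler_pdivrMr// mul1r; have := alphaE; lra.
- have -> : (j.+2%:Z - 1) = j.+1%:Z by lia.
  apply: (@le_trans _ _ s%:R).
    by rewrite ler_piMr//; lra.
  rewrite (pmulrn 1 s) ler_int -const_floor le_floor//.
  by rewrite -exprnP exprS ler_peMr ?(ltW al_gt0)// exprn_ege1// ltW.
Qed.

End FloorBound.

(** * The limit, then the explicit bound for constant quotients *)

Theorem theorem1p8 (R : realType) (alpha : R) (a : nat -> int) (s : nat)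
    (alpha_irr : irrational alpha) (alpha_cf : is_cf_expansion alpha a)
    (s_gt0 : (0 < s)%N) (a_le : forall i : nat, (0 < i)%N -> a i <= s%:Z) :
  (covering_number n (rotation alpha) @[n --> \oo] --> (1 : R)) /\
  ((forall i : nat, a i = s%:Z) ->
   forall j n : nat, (0 < n)%N ->
     alpha ^ (j%:Z - 1) * (alpha + 1) <= n%:R ->
     covering_number 1 (rotation alpha) * (1 / alpha ^+ j.+2) *
       ((Num.floor (alpha ^+ j.+1))%:~R * (Num.floor alpha)%:~R +
        (Num.floor (alpha ^+ j))%:~R)
     <= covering_number n (rotation alpha)).
Proof.
split.
  apply/cvgrPdist_le => eps eps_gt0.
  pose N := (Num.truncn eps^-1).+1.
  exists (2 * N * s.+2)%N => // n /= Nn.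
  have ach := bounded_type_achieves alpha_irr alpha_cf (ltn0Sn _) a_le Nn.
  have lb := achieves_le_covering_number ach.
  have ub : covering_number n (rotation alpha) <= 1.
    by apply: covering_number_le => // y; exact: achieves_le1.
  rewrite ger0_norm ?subr_ge0//.
  have : N%:R^-1 <= eps.
    by rewrite -[leRHS]invrK lef_pV2 ?posrE ?invr_gt0 ?ltr0n// ltW// truncnS_gt.
  by rewrite -/N in lb; lra.
move=> a_const j n _ n_ge.
have al_gt1 := const_gt1 alpha_irr alpha_cf a_const.
have alE := const_fixpoint alpha_irr alpha_cf a_const.
have al_gt0 : 0 < alpha by exact: lt_trans al_gt1.
pose N1 := `|Num.floor (alpha ^+ j)|%N.
pose N2 := `|Num.floor (alpha ^ (j%:Z - 1))|%N.
have absz_floor (x : R) : 0 <= x -> `|Num.floor x|%N%:R = (Num.floor x)%:~R :> R.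
  by move=> x_ge0; rewrite pmulrn gez0_abs// floor_ge0.
have N1E : N1%:R = (Num.floor (alpha ^+ j))%:~R :> R by rewrite absz_floor// exprn_ge0// ltW.
have N2E : N2%:R = (Num.floor (alpha ^ (j%:Z - 1)))%:~R :> R by rewrite absz_floor// exprz_ge0// ltW.
have N1_gt0 : (0 < N1)%N by rewrite -(ltr_nat R) N1E ltr0z floor_gt0 exprn_ege1// ltW.
have powE : alpha ^ (j%:Z - 1) = alpha ^+ j / alpha.
  by rewrite expfzDr ?gt_eqF// exprN1 exprnP.
have N1A : N1%:R <= alpha ^+ j by rewrite N1E floor_le.
have N2A : N2%:R <= alpha ^+ j / alpha by rewrite N2E -powE floor_le.
(* The hypothesis on [n] is alpha^j + alpha^(j-1) <= n, which bounds the sum of the floors. *)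
have Nn : (N1 + N2 <= n)%N.
  rewrite -(ler_nat R) (le_trans _ n_ge)// natrD powE mulrDr mulr1 divfK ?gt_eqF//.
  exact: lerD.
have powj_gt0 : 0 < alpha ^+ j by rewrite exprn_gt0.
rewrite (const_floor al_gt1 alE) -mulrA.
set c := 1 / _ * _.
pose W := N1%:R + N2%:R / alpha.
have c_le : c <= W / alpha ^+ j.
  rewrite /c div1r mulrC ler_pdivrMr ?exprn_gt0//.
  rewrite [in leRHS](_ : j.+2 = 2 + j)%N// exprD [leRHS]mulrCA mulrC divfK ?gt_eqF//.
  have := floor_pow_bound s_gt0 al_gt1 alE j.
  by rewrite -N1E -N2E (pmulrn 1 s) [in X in X -> _]mulrC.
have c_gt0 : 0 < c.
  rewrite /c div1r mulr_gt0 ?invr_gt0 ?exprn_gt0// -N1E ltr_wpDl ?ltr0n//.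
  by rewrite mulr_ge0// ler0z// floor_ge0 exprn_ge0 // ltW.
have F_ge0 := covering_number_ge0 alpha n.
(* Dividing by [c] reduces the claim to each value [y] achieved by one arc. *)
rewrite -ler_pdivlMr//; apply: covering_number_le => [|y y_ach].
  by rewrite divr_ge0// ltW.
rewrite ler_pdivlMr//; have [y_le0|y_gt0] := leP y 0.
  by apply: le_trans F_ge0; rewrite mulr_le0_ge0// ltW.
set t := y * (W / alpha ^+ j).
apply: (@le_trans _ _ t); first by rewrite ler_wpM2l// ltW.
have t_approx eps : 0 < eps < 1 -> (1 - eps) * t <= covering_number n (rotation alpha).
  move=> eps01; apply: achieves_le_covering_number.
  exact: (const_achieves alpha_irr alpha_cf a_const).
rewrite leNgt; apply/negP => F_lt; clearbody t.
have t_gt0 : 0 < t by exact: le_lt_trans F_lt.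
(* With this choice [(1 - eps) * t] is the midpoint of [t] and the covering number, contradicting
   [t_approx]. *)
pose eps := (t - covering_number n (rotation alpha)) / (2 * t).
have epsE : eps * t = (t - covering_number n (rotation alpha)) / 2.
  by rewrite /eps; field; rewrite gt_eqF.
have eps01 : 0 < eps < 1.
  apply/andP; split; first by rewrite /eps divr_gt0 ?subr_gt0// mulr_gt0.
  by rewrite /eps ltr_pdivrMr ?mulr_gt0//; lra.
by have := t_approx _ eps01; rewrite mulrBl epsE; lra.
Qed.
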